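(* For every integer $n \ge 1$, let $$a(n) = \sum_{k=1}^n \frac{\operatorname{lcm}(n, n-1, \ldots, n-k+2, n-k+1)}{\operatorname{lcm}(1,2,\ldots,k)}.$$ Then $a(n) \equiv 1 - m(n) \pmod 2$ for all $n \ge 1$.
   Context: For a non-negative integer $k$, $s_2(k)$ denotes the number of ones in the binary expansion of $k$. Define $\bar{t}(k) = 1$ if $s_2(k)$ is even and $\bar{t}(k)=0$ if $s_2(k)$ is odd. The sequence $m(n)$, $n \ge 0$, is defined by $m(2k) = \bar{t}(k)$ and $m(2k+1) = 0$ for all $k \ge 0$. Each term of the sum defining $a(n)$ is an integer. The sequence $a(n)$ is OEIS A093431, indexed from $n=1$: $1,3,7,13,31,38,113,165,\ldots$. *)

(* Defs.v *)
From mathcomp Require Import all_boot.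

Set Implicit Arguments.
Unset Strict Implicit.
Unset Printing Implicit Defensive.

(* Binary digits of index i >= k vanish, since k < 2 ^ k. *)
Definition s2 (k : nat) : nat := \sum_(0 <= i < k) odd (k %/ 2 ^ i).

Definition tbar (k : nat) : nat := if odd (s2 k) then 0 else 1.

Definition m (n : nat) : nat := if odd n then 0 else tbar n./2.

(* lcm(i, i + 1, ..., j) *)
Definition lcm_range (i j : nat) : nat := \big[lcmn/1]_(i <= l < j.+1) l.

(* The division is exact, see [a_term_dvd]. *)
Definition a_term (n k : nat) : nat :=
  lcm_range (n - k + 1) n %/ lcm_range 1 k.

Definition a (n : nat) : nat := \sum_(1 <= k < n.+1) a_term n k.

Lemma a_term_dvd (n k : nat) :
  k <= n -> lcm_range 1 k %| lcm_range (n - k + 1) n.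
Proof.
move=> le_kn; rewrite /lcm_range big_seq.
apply: (big_ind (fun x => x %| _)) => [|x y hx hy|l].
- exact: dvd1n.
- by rewrite dvdn_lcm hx.
rewrite mem_index_iota ltnS => /andP[l_gt0 le_lk].
have lt_mod : n %% l < l by rewrite ltn_mod.
have dvd_l : l %| n - n %% l by rewrite {1}(divn_eq n l) addnK dvdn_mull.
apply: (dvdn_trans dvd_l).
have in_r : n - n %% l \in index_iota (n - k + 1) n.+1.
  rewrite mem_index_iota ltnS leq_subr andbT addn1.
  by apply: ltn_sub2l; [apply: leq_trans le_kn; apply: leq_trans le_lk|
                        apply: leq_trans le_lk].
by rewrite (big_rem _ in_r) /= dvdn_lcml.
Qed.

Lemma m_le1 (n : nat) : m n <= 1.
Proof. by rewrite /m /tbar; case: (odd n) => //; case: (odd _). Qed.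

(* Main.v *)
Require Import Defs.
From mathcomp Require Import all_boot.

(** With [e] the integer logarithm of [k] in base 2, the [k]-th term is odd iff
    [(n - k, n]] contains no multiple of [2 ^ e.+1], i.e., iff
    [k <= n %% 2 ^ e.+1].  Hence the block [2 ^ e <= k < 2 ^ e.+1] contains
    [n %% 2 ^ e + 1] odd terms if bit [e] of [n] is set, and none otherwise.
    If [n] is odd only the block [e = 0] has an odd contribution; if [n] is even
    every set bit contributes an odd number, so that [a n] has the parity of
    [s2 n = s2 n./2]. *)

(** Valuations turn lcm into max. Zero is split off first, since [logn p 0 = 0] although [p ^ f]
    divides 0. *)
Lemma pfactor_dvdn_lcm (p f i j : nat) : prime p ->
  (p ^ f %| lcmn i j) = (p ^ f %| i) || (p ^ f %| j).
Proof.
move=> p_pr; have [->|i_gt0] := posnP i; first by rewrite lcm0n dvdn0.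
have [->|j_gt0] := posnP j; first by rewrite lcmn0 dvdn0 orbT.
by rewrite !pfactor_dvdn ?lcmn_gt0 ?i_gt0 // logn_lcm // leq_max.
Qed.

(** [0 < f] settles the empty list, whose lcm 1 is divisible by [p ^ 0]. *)
Lemma pfactor_dvdn_biglcm (p f : nat) (s : seq nat) : prime p -> 0 < f ->
  (p ^ f %| \big[lcmn/1]_(l <- s) l) = has (fun l => p ^ f %| l) s.
Proof.
move=> p_pr f_gt0; elim: s => [|x s IHs] /=.
  by rewrite big_nil dvdn1 -(expn0 p) eqn_exp2l ?prime_gt1 // gtn_eqF.
by rewrite big_cons pfactor_dvdn_lcm // IHs.
Qed.

(** The largest multiple of [d] up to [n] is [n - n %% d], and it exceeds [n - k] iff
    [n %% d < k]. *)
Lemma has_dvdn_last (d n k : nat) : 0 < d -> k <= n ->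
  has (dvdn d) (index_iota (n - k + 1) n.+1) = (n %% d < k).
Proof.
move=> d_gt0 le_kn; apply/hasP/idP => [[l]|lt_rk].
  rewrite mem_index_iota ltnS addn1 => /andP[lt_l le_ln] /= d_l.
  have -> : n %% d = (n - l) %% d.
    by rewrite -{1}(subnK le_ln) -modnDmr (eqP d_l) addn0.
  by apply: leq_ltn_trans (leq_mod _ _) _; rewrite ltn_subCl.
exists (n - n %% d); last by rewrite /= {1}(divn_eq n d) addnK dvdn_mull.
rewrite mem_index_iota ltnS leq_subr andbT addn1.
by rewrite ltn_sub2l // (leq_trans lt_rk).
Qed.

Lemma lcm_range_gt0 (i j : nat) : 0 < i -> 0 < lcm_range i j.
Proof.
move=> i_gt0; rewrite /lcm_range big_nat.
apply: (big_ind (fun x => 0 < x)) => // [x y x_gt0 y_gt0|l /andP[le_il _]].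
  by rewrite lcmn_gt0 x_gt0.
exact: leq_trans le_il.
Qed.

Lemma pfactor_dvdn_lcm_range (p f n k : nat) :
    prime p -> 0 < f -> k <= n ->
  (p ^ f %| lcm_range (n - k + 1) n) = (n %% p ^ f < k).
Proof.
move=> p_pr f_gt0 le_kn; rewrite pfactor_dvdn_biglcm // has_dvdn_last //.
by rewrite expn_gt0 prime_gt0.
Qed.

Lemma logn_lcm_range (p k : nat) : prime p -> 0 < k ->
  logn p (lcm_range 1 k) = trunc_log p k.
Proof.
move=> p_pr k_gt0; have L_gt0 := lcm_range_gt0 1 k isT.
have dvdL f : 0 < f -> (f <= logn p (lcm_range 1 k)) = (p ^ f <= k).
  move=> f_gt0; rewrite -pfactor_dvdn //.
  (* The range from 1 to [k] is the case [n = k], and [k %% p ^ f < k] iff [p ^ f <= k]. *)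
  have := pfactor_dvdn_lcm_range p f k k p_pr f_gt0 (leqnn k).
  rewrite subnn add0n => ->.
  have [lt_kf|le_fk] := ltnP k (p ^ f); first by rewrite modn_small // ltnn.
  by rewrite (leq_trans _ le_fk) // ltn_mod expn_gt0 prime_gt0.
have p_gt1 := prime_gt1 p_pr.
apply/eqP; rewrite eqn_leq; apply/andP; split.
  by rewrite leqNgt dvdL // -ltnNge trunc_log_ltn.
have [->//|e_gt0] := posnP (trunc_log p k).
by rewrite dvdL // trunc_logP.
Qed.

Lemma odd_a_term (n k : nat) : 0 < k -> k <= n ->
  odd (a_term n k) = (k <= n %% 2 ^ (trunc_log 2 k).+1).
Proof.
move=> k_gt0 le_kn.
have L_gt0 := lcm_range_gt0 1 k isT.
have M_gt0 : 0 < lcm_range (n - k + 1) n by rewrite lcm_range_gt0 ?addn1.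
have defM := divnK (a_term_dvd le_kn).
have q_gt0 : 0 < a_term n k by move: M_gt0; rewrite -defM muln_gt0 => /andP[].
(* As the denominator has 2-adic valuation [e = trunc_log 2 k], the quotient is even iff [2 ^ e.+1]
   divides the numerator. *)
rewrite leqNgt -pfactor_dvdn_lcm_range // pfactor_dvdn // -defM.
rewrite lognM // logn_lcm_range // -addn1 addnC leq_add2r.
by rewrite -(pfactor_dvdn 1) // expn1 dvdn2 negbK.
Qed.

Lemma modn_expS (n e : nat) :
  n %% 2 ^ e.+1 = odd (n %/ 2 ^ e) * 2 ^ e + n %% 2 ^ e.
Proof.
rewrite {1}(divn_eq n (2 ^ e)) -{1}(odd_double_half (n %/ 2 ^ e)).
rewrite mulnDl -muln2 -mulnA -expnS addnAC addnC modnMDl modn_small //.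
have lt_r : n %% 2 ^ e < 2 ^ e by rewrite ltn_mod expn_gt0.
rewrite expnS mul2n -addnn.
case: odd; first by rewrite mul1n ltn_add2l.
by rewrite mul0n add0n (leq_trans lt_r) ?leq_addr.
Qed.

(** Truncated subtraction also covers [r < i], where every summand is 0. *)
Lemma sum_leq_nat (i j r : nat) : r < j ->
  \sum_(i <= k < j) (k <= r) = r.+1 - i.
Proof.
move=> lt_rj; have -> : r.+1 - i = \sum_(i <= k < r.+1) 1.
  by rewrite sum_nat_const_nat muln1.
rewrite (big_nat_widen _ r.+1 j) // [RHS]big_mkcond.
by apply: eq_bigr => k _ /=; rewrite ltnS; case: (k <= r).
Qed.

Lemma sum_dyadic_block (n e : nat) :
  \sum_(2 ^ e <= k < 2 ^ e.+1) (k <= n %% 2 ^ (trunc_log 2 k).+1) =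
  odd (n %/ 2 ^ e) * (n %% 2 ^ e).+1.
Proof.
under eq_big_nat => k k_e do rewrite (trunc_log_eq _ k_e) //.
rewrite sum_leq_nat ?ltn_mod ?expn_gt0 // modn_expS.
(* If the bit is set, the bound is [2 ^ e + n %% 2 ^ e]; otherwise it lies below the block. *)
case: odd; first by rewrite !mul1n -addnS addKn.
by rewrite !mul0n; apply/eqP; rewrite subn_eq0 ltn_mod expn_gt0.
Qed.

Lemma sum_dyadic (n e : nat) :
  \sum_(1 <= k < 2 ^ e) (k <= n %% 2 ^ (trunc_log 2 k).+1) =
  \sum_(0 <= i < e) odd (n %/ 2 ^ i) * (n %% 2 ^ i).+1.
Proof.
elim: e => [|e IHe]; first by rewrite !big_geq.
rewrite (big_cat_nat (n := 2 ^ e)) ?expn_gt0 ?leq_exp2l //=.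
by rewrite IHe sum_dyadic_block big_nat_recr.
Qed.

Lemma odd_sum (s : seq nat) (F : nat -> nat) :
  odd (\sum_(i <- s) F i) = odd (\sum_(i <- s) odd (F i)).
Proof.
by elim: s => [|x s IHs]; rewrite ?big_nil // !big_cons !oddD IHs oddb.
Qed.

(** The sum is extended up to [2 ^ n - 1] to fill whole dyadic blocks; the added terms have [k > n]
    and vanish. The bit range [i < n] is then that of [s2 n]. *)
Lemma odd_a (n : nat) :
  odd (a n) = odd (\sum_(0 <= i < n) odd (n %/ 2 ^ i) * (n %% 2 ^ i).+1).
Proof.
have lt_n := ltn_expl n (isT : 1 < 2).
rewrite -sum_dyadic (big_cat_nat (n := n.+1)) //= [X in _ + X]big_nat_cond.
rewrite [X in _ + X]big1 ?addn0 => [|k /andP[/andP[lt_nk _] _]]; last first.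
  by rewrite leqNgt (leq_ltn_trans (leq_mod _ _)).
rewrite /a odd_sum; congr odd; apply: eq_big_nat => k /andP[k_gt0 le_kn].
by rewrite odd_a_term.
Qed.

Lemma odd_modn_exp (n i : nat) : 0 < i -> odd (n %% 2 ^ i) = odd n.
Proof. by move=> i_gt0; rewrite odd_mod // oddX gtn_eqF. Qed.

(** Doubling shifts the digits by one place; the longer range on the left only adds zero digits,
    since [i < 2 ^ i]. *)
Lemma s2_double (k : nat) : s2 k.*2 = s2 k.
Proof.
case: k => // k; rewrite /s2 {1}doubleS big_nat_recl // expn0 divn1 odd_double add0n.
rewrite (big_cat_nat (n := k.+1)) //=; last by rewrite ltnS -addnn leq_addr.
rewrite [X in _ + X]big_nat_cond [X in _ + X]big1 ?addn0 => [|i].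
  by apply: eq_bigr => i _; rewrite expnS -mul2n divnMl.
rewrite andbT => /andP[lt_ki _]; rewrite divn_small //.
rewrite expnS -mul2n ltn_pmul2l //.
exact: leq_ltn_trans lt_ki (ltn_expl _ _).
Qed.

Theorem lemma9 (n : nat) (hn : 1 <= n) : a n = 1 - m n %[mod 2].
Proof.
rewrite !modn2 odd_a odd_sum /m /tbar; congr nat_of_bool.
case: ifPn => [n_odd|n_even].
  case: n hn n_odd => // n _ n_odd; rewrite big_nat_recl // big_nat big1 //=.
    by rewrite expn0 divn1 modn1 muln1 oddb n_odd.
  (* For a positive exponent the remainder is odd like [n], so its successor is even. *)
  by move=> i _; rewrite oddM /= odd_modn_exp // n_odd andbF.
have -> : s2 n./2 = s2 n by rewrite -s2_double even_halfK.
under eq_bigr => i _.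
  have -> : odd (odd (n %/ 2 ^ i) * (n %% 2 ^ i).+1) = odd (n %/ 2 ^ i).
    (* Here every remainder is even, so its successor is odd and only the bit remains. *)
    rewrite oddM oddb /=; case: i => [|i]; first by rewrite modn1 andbT.
    by rewrite odd_modn_exp // n_even andbT.
  over.
by rewrite -/(s2 n); case: (odd (s2 n)).
Qed.
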